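(* Assume the strictly tailored condition, $\lambda^\star<\lambda<1$, and $0<\delta<1$. A stationary MPE exists. A stationary strategy pair $(\phi,z)$ is an MPE if and only if, at every $\alpha\in\Delta^n$, $$z(\alpha)\in z^*(\alpha),\qquad \phi(\alpha)\in\{\alpha^I(x):x\in\Gamma(\alpha)\}.$$ Every such equilibrium satisfies $C_{\phi,z}(\phi(\alpha);\alpha)=G(\alpha)/(1-\delta)$ for every $\alpha\in\Delta^n$. In particular, for every initial worldview $\alpha_0$ there is $x\in\Gamma(\alpha_0)$ such that $\alpha_t=\alpha^I(x)$ and $x_t=x$ for every $t\ge1$.
   Context: $J=\{1,\ldots,n\}$ and $X$ are nonempty finite sets (pure worldviews and actions) with payoffs $u_j(x)\in\mathbb R$. $\Delta^n=\{\alpha\in\mathbb R^n:\alpha^j\ge0,\ \sum_j\alpha^j=1\}$; $\alpha(j)$ is the vertex with weight one on $j$. $U(\alpha,x)=\sum_j\alpha^ju_j(x)$, $z^*(\alpha)=\arg\max_{x\in X}U(\alpha,x)$, $X^I=\bigcup_{\alpha\in\Delta^n}z^*(\alpha)$. Strictly tailored condition: for every $x\in X^I$ there is an index $i(x)\in J$ with $u_{i(x)}(x)>u_{i(x)}(y)$ for every $y\in X\setminus\{x\}$, and $u_{i(x)}(x)>u_j(x)$ for every $j\in J\setminus\{i(x)\}$. (The index is then unique and $x\mapsto i(x)$ is injective.) Write $\alpha^I(x)=\alpha(i(x))$. For distinct $x,y\in X^I$ put $D_{xy}=u_{i(x)}(x)-u_{i(x)}(y)>0$, $R_{xy}=u_{i(y)}(y)-u_{i(x)}(y)>0$,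 and $$\lambda^\star=\max\Big\{0,\max_{x,y\in X^I,\,x\ne y}\Big(1-\frac{D_{xy}}{R_{xy}}\Big)\Big\}\in[0,1),$$ with $\lambda^\star=0$ if $|X^I|=1$. For $x\in X^I$ put $g_x(\alpha)=(1-\lambda)u_{i(x)}(x)+\lambda U(\alpha,x)$, $G(\alpha)=\max_{x\in X^I}g_x(\alpha)$, $\Gamma(\alpha)=\arg\max_{x\in X^I}g_x(\alpha)$. A stationary pure strategy is a pair of arbitrary maps $\phi:\Delta^n\to\Delta^n$, $z:\Delta^n\to X$ (no continuity or measurability assumed). With $\phi^k$ the $k$-fold iterate, $$C_{\phi,z}(\beta;\alpha)=\sum_{k=0}^\infty\delta^k\big[(1-\lambda)U(\phi^k(\beta),z(\phi^k(\beta)))+\lambda U(\alpha,z(\phi^k(\beta)))\big].$$ A stationary MPE is a pair $(\phi,z)$ such that for every $\alpha$: $z(\alpha)\in z^*(\alpha)$, and $C_{\phi,z}(\phi(\alpha);\alpha)\ge C_{\phi,z}(\beta;\alpha)$ for every $\beta\in\Delta^n$. The path from $\alpha_0$ is $\alpha_{t+1}=\phi(\alpha_t)$, $x_t=z(\alpha_t)$. *)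

(* Defs.v *)
From HB Require Import structures.
From mathcomp Require Import all_boot all_order all_algebra.
From mathcomp Require Import all_classical all_reals all_analysis.
Set Implicit Arguments.
Unset Strict Implicit.
Unset Printing Implicit Defensive.
Import Order.TTheory GRing.Theory Num.Theory.
Import numFieldNormedType.Exports.
Local Open Scope ring_scope.

Section Simplex.
Variables (R : realType) (n : nat).

Definition in_simplex (a : 'rV[R]_n) : bool :=
  [forall j, 0 <= a ord0 j] && (\sum_j a ord0 j == 1).

Definition simplex := {a : 'rV[R]_n | in_simplex a}.

Lemma in_simplex_delta (j : 'I_n) : in_simplex (delta_mx ord0 j).
Proof.
apply/andP; split; first by apply/forallP => k; rewrite mxE ler0n.
rewrite (bigD1 j) //= big1 ?addr0 ?mxE ?eqxx //.
by move=> k kj; rewrite mxE (negbTE kj) andbF.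
Qed.

Definition vertex (j : 'I_n) : simplex :=
  exist (fun a => is_true (in_simplex a)) _ (in_simplex_delta j).

End Simplex.

(* The nonempty set of pure worldviews {1, ..., n} is rendered as 'I_n.+1. *)
Section Model.
Variables (R : realType) (n : nat) (X : finType).
Variable u : 'I_n.+1 -> X -> R.

Local Notation Delta := (simplex R n.+1).

Definition U (a : Delta) (x : X) : R := \sum_j val a ord0 j * u j x.

Definition zstar (a : Delta) : {set X} := [set x | [forall y, U a y <= U a x]].

Definition XI : {set X} := [set x | `[< exists a : Delta, x \in zstar a >]].

Definition tailored_to (x : X) (j : 'I_n.+1) : bool :=
  [forall y, (y != x) ==> (u j y < u j x)] &&
  [forall k, (k != j) ==> (u k x < u j x)].

Definition strictly_tailored : Prop :=
  forall x, x \in XI -> exists j, tailored_to x j.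

(* The index i(x); the default value ord0 only matters when no index is
   tailored to x, hence never on XI under strictly_tailored. *)
Definition idx (x : X) : 'I_n.+1 := odflt ord0 [pick j | tailored_to x j].

Definition alphaI (x : X) : Delta := vertex R (idx x).

Definition Dgap (x y : X) : R := u (idx x) x - u (idx x) y.

Definition Rgap (x y : X) : R := u (idx y) y - u (idx x) y.

(* The neutral element 0 accounts for the outer maximum with 0. *)
Definition lambda_star : R :=
  \big[Num.max/0]_(p : X * X | [&& p.1 \in XI, p.2 \in XI & p.1 != p.2])
    (1 - Dgap p.1 p.2 / Rgap p.1 p.2).

Section Discounting.
Variables (lambda delta : R).

Definition g (x : X) (a : Delta) : R :=
  (1 - lambda) * u (idx x) x + lambda * U a x.

(* A maximum: XI is finite, and it is nonempty as soon as X is. *)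
Definition G (a : Delta) : R := sup [set g x a | x in [set` XI]]%classic.

Definition Gamma (a : Delta) : {set X} :=
  [set x in XI | [forall y in XI, g y a <= g x a]].

(* The terms are bounded multiples of delta ^+ k, so that the series converges
   for 0 < delta < 1. *)
Definition C (phi : Delta -> Delta) (z : Delta -> X) (b a : Delta) : R :=
  limn (series (fun k => delta ^+ k *
    ((1 - lambda) * U (iter k phi b) (z (iter k phi b)) +
     lambda * U a (z (iter k phi b))))).

Definition stationary_MPE (phi : Delta -> Delta) (z : Delta -> X) : Prop :=
  forall a : Delta,
    z a \in zstar a /\ forall b : Delta, C phi z b a <= C phi z (phi a) a.

End Discounting.

Definition worldview_at (phi : Delta -> Delta) (a0 : Delta) (t : nat) : Delta :=
  iter t phi a0.

Definition action_at (phi : Delta -> Delta) (z : Delta -> X) (a0 : Delta)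
  (t : nat) : X := z (worldview_at phi a0 t).

End Model.

(* Main.v *)
Require Import Defs.
From HB Require Import structures.
From mathcomp Require Import all_boot all_order all_algebra.
From mathcomp Require Import all_classical all_reals all_analysis.
From mathcomp Require Import lra.
Import Order.TTheory GRing.Theory Num.Theory.
Import numFieldNormedType.Exports.
Local Open Scope ring_scope.

(* Whatever the strategy, a period spent at worldview b with the myopic action
   x pays an agent a at most g_x(a) <= G(a), with equality only if x is in
   Gamma(a) and b is the vertex alphaI(x); so G(a) / (1 - delta) bounds every
   continuation value. For lambda > lambda_star one has
   Gamma(alphaI(x)) = {x}. At alphaI(x) the current payoff already equals G, so
   the option of staying forces an equilibrium continuation value to meet the
   bound, whence alphaI(x) is absorbing. Choosing alphaI(x) with x in Gamma(a)
   thus attains the bound at every a, and an equilibrium choice must attain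
   it. *)

(** * Discounted sums of bounded sequences *)

Section DiscountedSums.
Context {R : realType}.
Implicit Types (d c M : R) (f : nat -> R).

Definition discounted d f : R := limn (series (fun k => d ^+ k * f k)).

Lemma is_cvg_discounted {d M f} : 0 < d -> d < 1 -> (forall k, `|f k| <= M) ->
  cvgn (series (fun k => d ^+ k * f k)).
Proof.
move=> d0 d1 fM; apply: normed_cvg.
have M0 : 0 <= M := le_trans (normr_ge0 _) (fM 0%N).
apply: (@series_le_cvg _ _ (geometric M d)) => [k|k|k|].
- exact: normr_ge0.
- by rewrite /geometric /= mulr_ge0// exprn_ge0// ltW.
- rewrite /geometric /= normrM gtr0_norm ?exprn_gt0// mulrC.
  by rewrite ler_pM2r ?exprn_gt0.
- by apply: is_cvg_geometric_series; rewrite gtr0_norm.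
Qed.

Lemma discounted_cst d c : 0 < d -> d < 1 ->
  discounted d (fun=> c) = c / (1 - d).
Proof.
move=> d0 d1; rewrite /discounted.
rewrite (_ : (fun k => d ^+ k * c) = geometric c d).
  by apply/cvg_lim => //; apply: cvg_geometric_series; rewrite gtr0_norm.
by apply/funext => k; rewrite /geometric /= mulrC.
Qed.

Lemma le_discounted d M c f : 0 < d -> d < 1 -> (forall k, `|f k| <= M) ->
  (forall k, f k <= c) -> discounted d f <= c / (1 - d).
Proof.
move=> d0 d1 fM fc; rewrite -discounted_cst// /discounted.
apply: lim_series_le; first exact: is_cvg_discounted fM.
- by apply: (@is_cvg_discounted d `|c|).
- by move=> k; rewrite ler_pM2l ?exprn_gt0.
Qed.

Lemma discountedS d M f : 0 < d -> d < 1 -> (forall k, `|f k| <= M) ->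
  discounted d f = f 0%N + d * discounted d (fun k => f k.+1).
Proof.
move=> d0 d1 fM; apply/cvg_lim => //.
(* Shifting the partial sums by one index lets the term of index 0 be split off each of them. *)
rewrite -cvg_shiftS /=.
have cv := is_cvg_discounted d0 d1 (fun k => fM k.+1).
rewrite (_ : (fun n => _) = fun n =>
    f 0%N + d * series (fun k => d ^+ k * f k.+1) n).
  by apply: cvgD; [exact: cvg_cst|exact: cvgMr].
apply/funext => m; rewrite /series /= big_nat_recl// expr0 mul1r; congr (_ + _).
by rewrite mulr_sumr; apply: eq_bigr => k _; rewrite exprS mulrA.
Qed.

End DiscountedSums.

(** * Expected payoffs on the simplex *)

Section Simplex.
Context {R : realType} {n : nat} {X : finType}.
Context {u : 'I_n.+1 -> X -> R}.
Local Notation Delta := (simplex R n.+1).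
Implicit Types (a b : Delta) (x : X) (j : 'I_n.+1).

Lemma simplex_ge0 a j : 0 <= val a ord0 j.
Proof. by case: a => a /= /andP[/forallP/(_ j)]. Qed.

Lemma simplex_sum1 a : \sum_j val a ord0 j = 1.
Proof. by case: a => a /= /andP[_ /eqP]. Qed.

Lemma U_vertex j x : U u (vertex R j) x = u j x.
Proof.
rewrite /U (bigD1 j)//= big1 ?addr0 ?mxE ?eqxx ?mul1r// => k /negbTE kj.
by rewrite mxE kj andbF mul0r.
Qed.

(** [U u b x] averages the [u k x] with weights [b], and [j] is their unique maximiser in [k];
    equality therefore leaves no weight off [j]. *)
Lemma leif_U_vertex {x j} b : tailored_to u x j ->
  U u b x <= u j x ?= iff (b == vertex R j).
Proof.
case/andP=> _ /forallP xj.
have uk k : u k x <= u j x.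
  by have [->//|kj] := eqVneq k j; apply: ltW; exact: (implyP (xj k)).
have le k : val b ord0 k * u k x <= val b ord0 k * u j x.
  by rewrite ler_wpM2l// simplex_ge0.
have S : u j x = \sum_k val b ord0 k * u j x.
  by rewrite -mulr_suml simplex_sum1 mul1r.
split; first by rewrite S; apply: ler_sum.
apply/eqP/eqP => [|->]; last exact: U_vertex.
move=> e.
(* By [e] the nonnegative gaps [val b ord0 k * (u j x - u k x)] sum to zero, so each vanishes; for
   [k != j] the second factor is positive. *)
have b0 k : k != j -> val b ord0 k = 0.
  move=> kj; have /allP/(_ k) : all (fun k => xpredT k ==>
      (val b ord0 k * u j x - val b ord0 k * u k x == 0)) (index_enum 'I_n.+1).
    rewrite -psumr_eq0 => [|i _]; last by rewrite subr_ge0.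
    by rewrite sumrB -S [X in _ - X]e subrr.
  rewrite mem_index_enum => /(_ isT) /=; rewrite -mulrBr mulf_eq0.
  case/orP=> [/eqP//|/eqP].
  by have := implyP (xj k) kj; rewrite -subr_gt0 => /gt_eqF/eqP.
apply: val_inj; apply/rowP => k; rewrite mxE /=.
have [->|kj] := eqVneq k j; last by rewrite b0// andbF.
by have := simplex_sum1 b; rewrite (bigD1 j)//= big1 ?addr0.
Qed.

(** Uniformity in [a] and [x] is what makes the series in [C] converge along the orbit of an
    arbitrary map [phi]. *)
Lemma bounded_U : exists M, forall a x, `|U u a x| <= M.
Proof.
exists (\sum_j \sum_x `|u j x|) => a x.
rewrite (le_trans (ler_norm_sum _ _ _))//; apply: ler_sum => j _.
rewrite normrM (ger0_norm (simplex_ge0 _ _)).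
have a1 : val a ord0 j <= 1.
  rewrite -(simplex_sum1 a) (bigD1 j)//= lerDl.
  by apply: sumr_ge0 => k _; exact: simplex_ge0.
rewrite (le_trans (ler_wpM2r _ a1))// mul1r (bigD1 x)//= lerDl.
exact: sumr_ge0.
Qed.

Lemma zstar_nonempty a : (0 < #|X|)%N -> exists x, x \in zstar u a.
Proof.
case/card_gt0P=> x0 _.
case: (arg_maxP (U u a) (isT : xpredT x0)) => x _ xmax.
by exists x; rewrite inE; apply/forallP => y; exact: xmax.
Qed.

Lemma zstar_XI {a x} : x \in zstar u a -> x \in XI u.
Proof. by move=> xa; rewrite inE; apply/asboolP; exists a. Qed.

Lemma XI_nonempty : (0 < #|X|)%N -> exists x, x \in XI u.
Proof.
move=> /(zstar_nonempty (vertex R ord0))[x xa].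
by exists x; exact: zstar_XI xa.
Qed.

End Simplex.

(** * One-period bounds and the sets [Gamma] *)

Section Equilibrium.
Context {R : realType} {n : nat} {X : finType}.
Context {u : 'I_n.+1 -> X -> R} {lambda delta : R}.
Hypothesis X_gt0 : (0 < #|X|)%N.
Hypothesis u_tailored : strictly_tailored u.
Hypothesis lambda_gt : lambda_star u < lambda.
Hypothesis lambda_lt1 : lambda < 1.
Hypothesis delta_gt0 : 0 < delta.
Hypothesis delta_lt1 : delta < 1.
Local Notation Delta := (simplex R n.+1).
Local Notation Gamma := (Gamma u lambda).
Local Notation G := (G u lambda).
Local Notation g := (g u lambda).
Local Notation C := (C u lambda delta).
Local Notation alphaI := (alphaI u).
Implicit Types (a b : Delta) (x y : X).

Definition payoff x b a : R := (1 - lambda) * U u b x + lambda * U u a x.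

Lemma idxP {x} : x \in XI u -> tailored_to u x (idx u x).
Proof.
by move=> /u_tailored[j xj]; rewrite /idx; case: pickP => //= /(_ j); rewrite xj.
Qed.

Lemma idx_ltl {x y} : x \in XI u -> y != x -> u (idx u x) y < u (idx u x) x.
Proof. by move=> /idxP/andP[/forallP/(_ y)/implyP + _]. Qed.

Lemma idx_ltr {x j} : x \in XI u -> j != idx u x -> u j x < u (idx u x) x.
Proof. by move=> /idxP/andP[_ /forallP/(_ j)/implyP]. Qed.

(** Two distinct actions sharing an index would each be strictly better than the other there. *)
Lemma idx_inj : {in XI u &, injective (idx u)}.
Proof.
move=> x y xI yI e; apply/eqP/negP => /negP xy.
have := idx_ltl yI xy; rewrite -e; apply/negP; rewrite -leNgt ltW//.
by apply: idx_ltl; rewrite // eq_sym.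
Qed.

Lemma leif_payoff_g {x} b a : x \in XI u ->
  payoff x b a <= g x a ?= iff (b == alphaI x).
Proof.
move=> xI; have [le eq] := leif_U_vertex b (idxP xI).
have l0 : 0 < 1 - lambda by rewrite subr_gt0.
split; first by rewrite lerD2r ler_pM2l.
by rewrite (inj_eq (addIr _)) (inj_eq (mulfI (lt0r_neq0 l0))).
Qed.

Lemma GammaP {x a} : reflect (x \in XI u /\ {in XI u, forall y, g y a <= g x a})
  (x \in Gamma a).
Proof.
rewrite [x \in Gamma a]inE; apply: (iffP andP) => -[xI xmax]; split=> //;
  exact/forall_inP.
Qed.

Lemma Gamma_nonempty a : exists x, x \in Gamma a.
Proof.
have [x0 x0I] := @XI_nonempty _ _ _ u X_gt0.
case: (arg_maxP (g^~ a) x0I) => x xI xmax.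
by exists x; apply/GammaP; split=> // y; exact: xmax.
Qed.

Lemma GammaE {a x} : x \in Gamma a -> G a = g x a.
Proof.
case/GammaP=> xI xmax; apply/le_anti/andP; split.
  apply: ge_sup; first by exists (g x a), x.
  by move=> _ [y yI <-]; exact: xmax.
apply: ub_le_sup; last by exists x.
by exists (g x a) => _ [y yI <-]; exact: xmax.
Qed.

Lemma g_le_G {a x} : x \in XI u -> g x a <= G a.
Proof.
move=> xI; have [y ya] := Gamma_nonempty a; rewrite (GammaE ya).
by case/GammaP: ya => _; apply.
Qed.

(** The chain [payoff x b a <= g x a <= G a] collapses to equalities; the first identifies [b], the
    second places [x] in [Gamma a]. *)
Lemma G_le_payoff {x b a} : x \in XI u -> G a <= payoff x b a ->
  x \in Gamma a /\ b = alphaI x.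
Proof.
move=> xI Gp; have [le eq] := leif_payoff_g b a xI.
have gG : g x a = G a.
  by apply/le_anti; rewrite g_le_G//= (le_trans Gp).
split.
  by apply/GammaP; split=> // y yI; rewrite gG g_le_G.
by apply/eqP; rewrite -eq eq_le le gG.
Qed.

(** This is where [lambda_star] comes from. At [alphaI x] the left side is
    [u (idx x) y + (1 - lambda) * Rgap x y] and the right side is [u (idx x) x], so the claim reads
    [(1 - lambda) * Rgap x y < Dgap x y], that is, [1 - Dgap x y / Rgap x y < lambda]. *)
Lemma g_alphaI_lt x y : x \in XI u -> y \in XI u -> y != x ->
  g y (alphaI x) < g x (alphaI x).
Proof.
move=> xI yI yx; rewrite /g !U_vertex.
have R0 : 0 < Rgap u x y.
  rewrite subr_gt0 idx_ltr//; apply: contra_neq yx => e.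
  by apply/esym/idx_inj.
have : 1 - Dgap u x y / Rgap u x y < lambda.
  apply: le_lt_trans lambda_gt.
  by apply: (@le_bigmax_cond _ _ _ _ (x, y)); rewrite /= xI yI eq_sym.
rewrite ltrBlDl -ltrBlDr ltr_pdivlMr// /Dgap /Rgap; lra.
Qed.

Lemma Gamma_alphaI {x y} : x \in XI u -> (y \in Gamma (alphaI x)) = (y == x).
Proof.
move=> xI; have sub z : z \in Gamma (alphaI x) -> z = x.
  case/GammaP=> zI /(_ _ xI) /=.
  by apply: contraTeq => zx; rewrite -ltNge g_alphaI_lt.
apply/idP/eqP => [/sub//|->].
(* [Gamma] is nonempty, and its only possible element is [x]. *)
by have [z zG] := Gamma_nonempty (alphaI x); rewrite -{1}(sub _ zG).
Qed.

Lemma zstar_alphaI x y : x \in XI u -> y \in zstar u (alphaI x) -> y = x.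
Proof.
move=> xI; rewrite inE => /forallP/(_ x); rewrite !U_vertex.
by apply: contraTeq => yx; rewrite -ltNge idx_ltl.
Qed.

(** * Continuation values under myopic actions *)

Section Strategy.
Context {phi : Delta -> Delta} {z : Delta -> X}.
Hypothesis z_zstar : forall a, z a \in zstar u a.
Local Notation V := (C phi z).

Let z_XI a : z a \in XI u. Proof. exact: zstar_XI (z_zstar a). Qed.

Lemma payoff_le_G b a : payoff (z b) b a <= G a.
Proof. by rewrite (le_trans (leif_payoff_g _ _ (z_XI b)))// g_le_G. Qed.

Lemma bounded_payoff a : exists M, forall b, `|payoff (z b) b a| <= M.
Proof.
have [M UM] := @bounded_U _ _ _ u.
exists (`|1 - lambda| * M + `|lambda| * M) => b.
by rewrite (le_trans (ler_normD _ _))// !normrM lerD// ler_wpM2l.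
Qed.

Lemma C_discounted b a : V b a =
  discounted delta (fun k => payoff (z (iter k phi b)) (iter k phi b) a).
Proof. by []. Qed.

Lemma C_le b a : V b a <= G a / (1 - delta).
Proof.
have [M wM] := bounded_payoff a.
by apply: (@le_discounted _ _ M) => // k; [exact: wM|exact: payoff_le_G].
Qed.

Lemma C_rec b a : V b a = payoff (z b) b a + delta * V (phi b) a.
Proof.
have [M wM] := bounded_payoff a.
rewrite !C_discounted (@discountedS _ _ M)//; congr (_ + _ * discounted _ _).
by apply/funext => k; rewrite iterSr.
Qed.

Lemma C_absorbed v a : phi v = v -> V v a = payoff (z v) v a / (1 - delta).
Proof.
move=> pv; rewrite C_discounted -discounted_cst//; congr discounted.
by apply/funext => k; rewrite iter_fix.
Qed.

Lemma z_alphaI x : x \in XI u -> z (alphaI x) = x.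
Proof. by move=> xI; apply: zstar_alphaI. Qed.

Lemma C_alphaI x a : x \in XI u -> phi (alphaI x) = alphaI x ->
  V (alphaI x) a = g x a / (1 - delta).
Proof.
move=> xI px; rewrite C_absorbed// z_alphaI//; congr (_ / _).
by apply/eqP; rewrite (leif_payoff_g _ _ xI).
Qed.

(** By [C_rec] and [C_le] the future contributes at most [delta] times the bound, so the current
    payoff is at least [(1 - delta)] times the bound, which is [G a]. *)
Lemma C_ge_G {b a} : G a / (1 - delta) <= V b a ->
  z b \in Gamma a /\ b = alphaI (z b).
Proof.
have d1 : 1 - delta != 0 by rewrite gt_eqF// subr_gt0.
move=> CG; apply: (G_le_payoff (z_XI b)); rewrite -[G a](divfK d1).
have := C_le (phi b) a; rewrite -(ler_pM2l delta_gt0); move: CG; rewrite C_rec.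
by move: (G a / _) (payoff _ _ _) (V _ _) => q p c; lra.
Qed.

(** * Sufficiency: selections from [Gamma] are equilibria *)

Section Optimal.
Hypothesis phi_Gamma : forall a, exists2 x, x \in Gamma a & phi a = alphaI x.

Lemma phi_alphaI x : x \in XI u -> phi (alphaI x) = alphaI x.
Proof.
by move=> xI; have [y] := phi_Gamma (alphaI x); rewrite Gamma_alphaI// => /eqP->.
Qed.

Lemma C_phi a : V (phi a) a = G a / (1 - delta).
Proof.
have [x xa ->] := phi_Gamma a; have [xI _] := GammaP xa.
by rewrite C_alphaI ?phi_alphaI// (GammaE xa).
Qed.

Lemma Gamma_MPE : stationary_MPE u lambda delta phi z.
Proof. by move=> a; split=> // b; rewrite C_phi C_le. Qed.

Lemma path_absorbed a0 : exists2 x, x \in Gamma a0 &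
  forall t, (1 <= t)%N ->
    worldview_at phi a0 t = alphaI x /\ action_at phi z a0 t = x.
Proof.
have [x xa px] := phi_Gamma a0; have [xI _] := GammaP xa.
exists x => // -[//|t] _.
(* The first application of [phi] reaches [alphaI x]; the remaining [t] stay there. *)
have e : worldview_at phi a0 t.+1 = alphaI x.
  by rewrite /worldview_at iterSr px iter_fix// phi_alphaI.
by rewrite /action_at e z_alphaI.
Qed.

End Optimal.

(** * Necessity: equilibria select from [Gamma] *)

Section MPE.
Hypothesis mpe : stationary_MPE u lambda delta phi z.

(* With v := alphaI x and c := V (phi v) v, optimality against staying at v
   reads c >= G v + delta * c, that is c >= G v / (1 - delta). *)
Lemma MPE_phi_alphaI x : x \in XI u -> phi (alphaI x) = alphaI x.
Proof.
move=> xI; set v := alphaI x.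
have pG : payoff (z v) v v = G v.
  rewrite (@GammaE v x) ?Gamma_alphaI//.
  by rewrite /v z_alphaI//; apply/eqP; rewrite (leif_payoff_g _ _ xI).
have [] := @C_ge_G (phi v) v; last by rewrite Gamma_alphaI// => /eqP->.
have [_ /(_ v)] := mpe v; rewrite C_rec pG ler_pdivrMr ?subr_gt0//.
by move: (V _ _) => c; lra.
Qed.

(** Since [alphaI x] is absorbing, deviating to it with [x] in [Gamma a] earns the full bound, so
    [phi a] must earn it too and [C_ge_G] applies. *)
Lemma MPE_phi_Gamma a : exists2 x, x \in Gamma a & phi a = alphaI x.
Proof.
have [x xa] := Gamma_nonempty a; have [xI _] := GammaP xa.
have [] := @C_ge_G (phi a) a; last by exists (z (phi a)).
by rewrite (GammaE xa) -C_alphaI ?MPE_phi_alphaI//; case: (mpe a).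
Qed.

End MPE.
End Strategy.

Lemma MPE_iff phi z : stationary_MPE u lambda delta phi z <->
  forall a, z a \in zstar u a /\ exists2 x, x \in Gamma a & phi a = alphaI x.
Proof.
split=> [mpe a|H]; last first.
  by apply: Gamma_MPE => a; case: (H a).
have zz b : z b \in zstar u b by case: (mpe b).
by split; [exact: zz|exact: MPE_phi_Gamma].
Qed.

(** Strategies are arbitrary maps, so pointwise choice from the nonempty sets [Gamma a] and
    [zstar u a] suffices. *)
Lemma MPE_exists : exists phi z, stationary_MPE u lambda delta phi z.
Proof.
have /choice[c cG] : forall a, exists x, x \in Gamma a := Gamma_nonempty.
have /choice[z zz] : forall a, exists x, x \in zstar u a.
  by move=> a; exact: zstar_nonempty.
exists (alphaI \o c), z; apply/MPE_iff => a; split; first exact: zz.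
by exists (c a); first exact: cG.
Qed.

End Equilibrium.

Theorem theorem6 (R : realType) (n : nat) (X : finType)
  (u : 'I_n.+1 -> X -> R) (lambda delta : R)
  (X_nonempty : (0 < #|X|)%N)
  (u_tailored : strictly_tailored u)
  (lambda_gt : lambda_star u < lambda) (lambda_lt1 : lambda < 1)
  (delta_gt0 : 0 < delta) (delta_lt1 : delta < 1) :
  (exists (phi : simplex R n.+1 -> simplex R n.+1) (z : simplex R n.+1 -> X),
      stationary_MPE u lambda delta phi z) /\
  (forall (phi : simplex R n.+1 -> simplex R n.+1) (z : simplex R n.+1 -> X),
      stationary_MPE u lambda delta phi z <->
      forall a : simplex R n.+1,
        z a \in zstar u a /\
        exists2 x, x \in Gamma u lambda a & phi a = alphaI u x) /\
  (forall (phi : simplex R n.+1 -> simplex R n.+1) (z : simplex R n.+1 -> X),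
      stationary_MPE u lambda delta phi z ->
      (forall a : simplex R n.+1,
          C u lambda delta phi z (phi a) a = G u lambda a / (1 - delta)) /\
      (forall a0 : simplex R n.+1,
          exists2 x, x \in Gamma u lambda a0 &
            forall t : nat, (1 <= t)%N ->
              worldview_at phi a0 t = alphaI u x /\
              action_at phi z a0 t = x)).
Proof.
split; first exact: MPE_exists.
split=> phi z; first exact: MPE_iff.
move=> mpe; have zz b : z b \in zstar u b by case: (mpe b).
have pG : forall a, exists2 x, x \in Gamma u lambda a & phi a = alphaI u x.
  exact: MPE_phi_Gamma mpe.
by split=> a; [exact: C_phi|exact: path_absorbed].
Qed.
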